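(* There exists a natural number $n_0$ such that for every integer $n\ge n_0$ we have $\mathrm{ex}(n,K_3,\hat{P_4})=\lfloor n^2/8\rfloor$.
   Context: All graphs are finite and simple. $P_4$ denotes the path on four vertices (three edges). The suspension $\hat{F}$ of a graph $F$ is obtained by adding one additional vertex $v$ to $F$ and, for each vertex $u\in V(F)$, adding the edge $uv$; thus $\hat{P_4}$ has five vertices and consists of a $P_4$ together with a vertex adjacent to each of its four vertices. A graph is $F$-free if it contains no (not necessarily induced) subgraph isomorphic to $F$. $\mathrm{ex}(n,H,F)$ denotes the largest number of copies of $H$ (i.e. subgraphs isomorphic to $H$, not necessarily induced) in an $F$-free graph on $n$ vertices; in particular $\mathrm{ex}(n,K_3,\hat{P_4})$ is the largest number of triangles in a $\hat{P_4}$-free $n$-vertex graph. *)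

(* Defs.v *)
From HB Require Import structures.
From mathcomp Require Import all_boot.

Set Implicit Arguments.
Unset Strict Implicit.
Unset Printing Implicit Defensive.

(* A finite simple graph with vertex set the whole type T; its edges are
   2-element sets of vertices. As a subtype of {set {set T}}, the graphs on T
   form a finite type. *)
Record sgraph (T : finType) := SGraph {
  edges : {set {set T}};
  edges_card2 : [forall e in edges, #|e| == 2]
}.

HB.instance Definition _ (T : finType) := [isSub for @edges T].
HB.instance Definition _ (T : finType) := [Finite of sgraph T by <:].

Section Constructions.

Variable T : finType.

Lemma complete_card2 : [forall e in [set e : {set T} | #|e| == 2], #|e| == 2].
Proof. by apply/forall_inP => e; rewrite inE. Qed.

Definition complete_graph : sgraph T := SGraph complete_card2.

Definition suspension_edges (F : sgraph T) : {set {set option T}} :=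
  [set Some @: e | e : {set T} in edges F]
  :|: [set [set None; Some u] | u in [set: T]].

Lemma suspension_card2 (F : sgraph T) :
  [forall e in suspension_edges F, #|e| == 2].
Proof.
apply/forall_inP => e /setUP[/imsetP[d dF ->]|/imsetP[u _ ->]].
  by rewrite card_imset ?(forall_inP (edges_card2 F)) // => x y [].
by rewrite cards2.
Qed.

(* The added vertex is None. *)
Definition suspension (F : sgraph T) : sgraph (option T) :=
  SGraph (suspension_card2 F).

End Constructions.

Definition path_edges (k : nat) : {set {set 'I_k}} :=
  [set e | [exists i : 'I_k, exists j : 'I_k,
    (j == i.+1 :> nat) && (e == [set i; j])]].

Lemma path_card2 (k : nat) : [forall e in path_edges k, #|e| == 2].
Proof.
apply/forall_inP => e; rewrite inE.
case/existsP=> i /existsP[j /andP[/eqP ij /eqP ->]].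
by rewrite cards2 -val_eqE /= ij neq_ltn leqnn.
Qed.

(* k is the number of vertices. *)
Definition path_graph (k : nat) : sgraph 'I_k := SGraph (path_card2 k).

Definition K3 : sgraph 'I_3 := complete_graph 'I_3.
Definition P4 : sgraph 'I_4 := path_graph 4.

Section Copies.

Variables U T : finType.

(* S = (W, D) is a subgraph of G with vertex set W and edge set D. *)
Definition is_subgraph (S : {set T} * {set {set T}}) (G : sgraph T) : bool :=
  (S.2 \subset edges G) && [forall e in S.2, e \subset S.1].

Definition isomorphic (H : sgraph U) (S : {set T} * {set {set T}}) : bool :=
  [exists f : {ffun U -> T},
    [&& injectiveb f, f @: [set: U] == S.1
      & [set f @: e | e : {set U} in edges H] == S.2]].

Definition copies (H : sgraph U) (G : sgraph T)
    : {set {set T} * {set {set T}}} :=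
  [set S | is_subgraph S G & isomorphic H S].

Definition free (F : sgraph U) (G : sgraph T) : bool := copies F G == set0.

End Copies.

(* ex(n, H, F). If F has an edge, the edgeless graph is F-free, so the maximum
   is over a nonempty set; a maximum over the empty set is 0. *)
Definition turan_ex (n : nat) (U V : finType) (H : sgraph U) (F : sgraph V)
    : nat :=
  \max_(G : sgraph 'I_n | free F G) #|copies H G|.

(* Main.v *)
(* Let G be free of the suspension of P4. A vertex outside a K4 has at most one
   neighbour in it, so no triangle outside a K4 shares an edge with it; and a
   triangle in no K4 (a loose triangle) has an apex z such that its two edges
   at z lie in no other triangle. Let l(v) be the number of edges at v that
   join the apex of a loose triangle to another vertex of it, k(v) the number
   of K4s through v, and d(v) = l(v) + 3 k(v). These edges and those of the
   K4s are all distinct, and they satisfy Mantel-like bounds: d(z) + d(x) <= n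
   for such an edge zx, and the sum of d over a K4 is at most n + 8. With t
   loose triangles and q K4s, the weights D = l + 4 k have sum 4 (t + 4 q) and,
   since 3 D^2 <= 3 l d + 16 k d,
     3 sum D^2 <= 6 n t + 16 (n + 8) q <= 6 n (t + 4 q)   for n >= 16.
   Cauchy-Schwarz then gives 8 (t + 4 q) <= n^2, and there are at most t + 4 q
   triangles. For the lower bound, join a perfect matching on 2k vertices
   completely to n - 2k independent vertices, with k = (n + 1) / 4 rounded
   down. *)
Require Import Defs.
From mathcomp Require Import all_boot zify.

Set Implicit Arguments.
Unset Strict Implicit.
Unset Printing Implicit Defensive.

(** * Preliminaries: Cauchy-Schwarz, cliques and fans of a relation *)

Lemma sum_sqr_leq (I : finType) (D : I -> nat) :
  (\sum_i D i) ^ 2 <= #|I| * \sum_i D i ^ 2.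
Proof.
(* Doubling turns both sides into sums over pairs (i, j), compared termwise. *)
suff H : 2 * (\sum_i D i) ^ 2 <= 2 * (#|I| * \sum_i D i ^ 2).
  by rewrite leq_mul2l in H.
have -> : 2 * (\sum_i D i) ^ 2 = \sum_i \sum_j 2 * (D i * D j).
  rewrite -mulnn big_distrlr /= big_distrr /=.
  by apply: eq_bigr => i _; rewrite big_distrr.
have -> : 2 * (#|I| * \sum_i D i ^ 2) = \sum_i \sum_j (D i ^ 2 + D j ^ 2).
  under [RHS]eq_bigr do rewrite big_split /= sum_nat_const.
  by rewrite [RHS]big_split /= sum_nat_const -big_distrr /= addnn mul2n.
by apply: leq_sum => i _; apply: leq_sum => j _; apply: nat_Cauchy.
Qed.

Definition cliques (T : finType) (e : rel T) (k : nat) : {set {set T}} :=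
  [set A : {set T} | (#|A| == k)
     && [forall x in A, forall y in A, (x != y) ==> e x y]].

Lemma cliqueP (T : finType) (e : rel T) k (A : {set T}) :
  reflect (#|A| = k /\ {in A &, forall x y, x != y -> e x y}) (A \in cliques e k).
Proof.
rewrite inE; apply: (iffP andP) => [[/eqP cA /forall_inP H]|[cA H]]; split => //.
- move=> x y xA yA; move/forall_inP: (H x xA) => /(_ y yA) /implyP; exact.
- exact/eqP.
- by apply/forall_inP=> x xA; apply/forall_inP=> y yA; apply/implyP; apply: H.
Qed.
Arguments cliqueP {T e k A}.

(* The other inequalities among [v], [a], [b], [c], [d] follow from adjacency. *)
Definition fan_free (T : finType) (e : rel T) : Prop := forall v a b c d : T,
  [&& a != c, a != d & b != d] -> [&& e v a, e v b, e v c & e v d] ->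
  ~~ [&& e a b, e b c & e c d].

(** * Local structure of K4s and loose triangles *)

Section TriangleBound.

Variables (T : finType) (e : rel T).
Hypotheses (esym : symmetric e) (eirr : irreflexive e).
Hypothesis efan : fan_free e.

Definition loose_triangles : {set {set T}} :=
  [set A in cliques e 3 | [forall K in cliques e 4, ~~ (A \subset K)]].

Lemma adj_neq x y : e x y -> x != y.
Proof. by case: eqVneq => // ->; rewrite eirr. Qed.

Lemma card3_split (A : {set T}) x y : #|A| = 3 -> x \in A -> y \in A -> x != y ->
  exists z, [/\ z != x, z != y & A = [set x; y; z]].
Proof.
move=> cA xA yA xy.
have : #|A :\ x :\ y| == 1.
  have := cardsD1 x A; have := cardsD1 y (A :\ x).
  by rewrite cA xA !inE eq_sym xy yA; lia.
case/cards1P=> z Ez; exists z.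
have : z \in A :\ x :\ y by rewrite Ez inE.
rewrite !inE => /and3P[zy zx zA]; split=> //.
apply/setP=> w; move/setP/(_ w): Ez; rewrite !inE.
case: (eqVneq w x) => [->|]; first by rewrite xA.
by case: (eqVneq w y) => [->|] //=; rewrite ?yA ?orbT.
Qed.

(** If [w] were adjacent to [a] and [b], with [c], [d] the rest of [K], then [a] would be joined to
    the whole path [w], [b], [c], [d]. *)
Lemma clique4_outside (K : {set T}) a b w :
  K \in cliques e 4 -> a \in K -> b \in K -> a != b -> w \notin K ->
  ~~ (e w a && e w b).
Proof.
case/cliqueP=> cK eK aK bK ab wK.
have c3 : #|K :\ a| = 3 by have := cardsD1 a K; rewrite cK aK; lia.
have : 0 < #|K :\ a :\ b|.
  by have := cardsD1 b (K :\ a); rewrite c3 !inE eq_sym ab bK; lia.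
case/card_gt0P=> c; rewrite !inE => /and3P[cb ca cK'].
have [|||d [db dc EK]] := @card3_split (K :\ a) b c c3; rewrite ?inE ?ca ?cK' 1?eq_sym ?ab ?bK //.
have : d \in K :\ a by rewrite EK !inE eqxx !orbT.
rewrite !inE => /andP[da dK].
apply/negP=> /andP[wa wb].
have wN x : x \in K -> w != x by move=> xK; apply: contraNneq wK => ->.
have := @efan a w b c d.
by rewrite !wN // [b == d]eq_sym db (esym a w) wa wb !eK // 1?eq_sym // => /(_ isT isT).
Qed.

(* The two edges of the triangle [A] at [z] lie in no other triangle. *)
Definition apex (A : {set T}) (z : T) : bool :=
  (z \in A) && [forall x in A :\ z, forall w in ~: A, ~~ (e w z && e w x)].

(** If some outside [w] is adjacent to two vertices [x], [y] of [A], the third vertex is an apex;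
    otherwise any vertex is. *)
Lemma loose_apex (A : {set T}) : A \in loose_triangles -> exists z, apex A z.
Proof.
rewrite inE => /andP[tA /forall_inP nK4]; have [cA eA] := cliqueP tA.
have notK4 w : w \notin A -> ~~ [forall x in A, e w x].
  move=> wA; apply/negP=> /forall_inP ew.
  suff /nK4 : w |: A \in cliques e 4 by rewrite subsetUr.
  apply/cliqueP; split=> [|x y]; first by rewrite cardsU1 wA cA.
  rewrite !inE => /orP[/eqP->|xA] /orP[/eqP->|yA]; rewrite ?eqxx //.
  - by move=> _; apply: ew.
  - by move=> _; rewrite esym; apply: ew.
  - exact: eA.
case: (boolP [exists x in A, exists y in A :\ x, exists w in ~: A, e w x && e w y]).
  case/exists_inP=> x xA /exists_inP[y]; rewrite !inE => /andP[yx yA].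
  case/exists_inP=> w; rewrite inE => wA /andP[wx wy].
  have [|z [zx zy EA]] := card3_split cA xA yA; first by rewrite eq_sym.
  have zA : z \in A by rewrite EA !inE eqxx !orbT.
  have nwz : ~~ e w z.
    apply: contra (notK4 _ wA) => wz; apply/forall_inP=> u.
    by rewrite EA !inE -orbA => /or3P[]/eqP->.
  exists z; rewrite /apex zA; apply/forall_inP=> u; rewrite !inE => /andP[uz uA].
  apply/forall_inP=> w'; rewrite inE => w'A; apply/negP=> /andP[w'z w'u].
  have ww' : w' != w by apply: contraNneq nwz => <-.
  have wN t : t \in A -> (w == t) = false by move=> tA'; apply: contraNF wA => /eqP->.
  have w'N t : t \in A -> (w' == t) = false by move=> tA'; apply: contraNF w'A => /eqP->.
  move: uA; rewrite EA !inE (negbTE uz) orbF => /orP[]/eqP Eu; subst u.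
    (* The fan with centre [x] and path [w'], [z], [y], [w]; then the same with [x] and [y]
       exchanged. *)
    have := @efan x w' z y w.
    rewrite (w'N y) // ww' [z == w]eq_sym (wN z) //= !(esym x) w'u wx.
    by rewrite (eA z x) // (eA y x) // (eA z y) // w'z (esym y w) wy => /(_ isT isT).
  have := @efan y w' z x w.
  rewrite (w'N x) // ww' [z == w]eq_sym (wN z) //= !(esym y) w'u wy.
  by rewrite (eA z y) // (eA x y) 1?eq_sym // (eA z x) // w'z (esym x w) wx => /(_ isT isT).
move=> H.
have /card_gt0P[z zA] : 0 < #|A| by rewrite cA.
exists z; rewrite /apex zA; apply/forall_inP=> u uA.
apply/forall_inP=> w wA; apply: contra H => H.
apply/exists_inP; exists z => //; apply/exists_inP; exists u => //.
by apply/exists_inP; exists w.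
Qed.

(** * Links and their Mantel-like bounds *)

Variable z : {set T} -> T.
Hypothesis z_apex : forall A, A \in loose_triangles -> apex A (z A).

Definition blocks := loose_triangles :|: cliques e 4.

(* For a loose triangle, the edge opposite to the apex is not a link: it may be
   shared by many triangles. *)
Definition link (A : {set T}) (u v : T) : bool :=
  [&& u \in A, v \in A, u != v & [|| #|A| == 4, u == z A | v == z A]].

Lemma block_card A : A \in blocks -> A \in loose_triangles /\ #|A| = 3 \/ A \in cliques e 4 /\ #|A| = 4.
Proof.
case/setUP=> AA; [left|right]; split=> //; last by have [] := cliqueP AA.
by move: AA; rewrite inE => /andP[/cliqueP[]].
Qed.

Lemma block_adj A u v : A \in blocks -> u \in A -> v \in A -> u != v -> e u v.
Proof.
case/setUP; last by case/cliqueP=> _; apply.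
by rewrite inE => /andP[/cliqueP[_ eA] _]; apply: eA.
Qed.

Lemma link_adj A u v : A \in blocks -> link A u v -> e u v.
Proof. by move=> bA /and4P[uA vA uv _]; apply: block_adj bA _ _ _. Qed.

(** For a K4 this is [clique4_outside]. In a loose triangle one end of a link is the apex, and the
    triangle's edges there lie in no other triangle. *)
Lemma link_closed A u v w : A \in blocks -> link A u v -> e w u -> e w v -> w \in A.
Proof.
move=> /block_card[[tA cA]|[qA _]] /and4P[uA vA uv]; last first.
  move=> _ wu wv; apply: contraT => /(clique4_outside qA uA vA uv).
  by rewrite wu wv.
rewrite cA /=; have /andP[zA /forall_inP nz] := z_apex tA.
move=> H wu wv; apply: contraT => wA.
case/orP: H => /eqP E.
  have /nz/forall_inP/(_ w) : v \in A :\ z A by rewrite !inE -E eq_sym uv.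
  by rewrite inE -E wu wv => /(_ wA).
have /nz/forall_inP/(_ w) : u \in A :\ z A by rewrite !inE -E uv.
by rewrite inE -E wu wv => /(_ wA).
Qed.

(** Any further vertex of [B] is a common neighbour of the ends of the link. *)
Lemma link_sub A B u v : A \in blocks -> B \in blocks -> link A u v ->
  u \in B -> v \in B -> B \subset A.
Proof.
move=> bA bB lA uB vB; have /and4P[uA vA _ _] := lA.
apply/subsetP=> w wB.
have [->//|wu] := eqVneq w u; have [->//|wv] := eqVneq w v.
by apply: (link_closed bA lA); apply: (block_adj bB).
Qed.

Lemma link_uniq A B u v : A \in blocks -> B \in blocks -> link A u v -> link B u v -> A = B.
Proof.
move=> bA bB lA lB; have /and4P[uA vA _ _] := lA; have /and4P[uB vB _ _] := lB.
apply/eqP; rewrite eqEsubset.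
by rewrite (link_sub bB bA lB) // (link_sub bA bB lA).
Qed.

(** Takes only the values 0 and 1, so this is the adjacency matrix of the graph of all links; its
    sum over [u] is d(v). *)
Definition linked (u v : T) : nat := #|[set A in blocks | link A u v]|.

Lemma linked_gt0 u v : 0 < linked u v -> exists2 A, A \in blocks & link A u v.
Proof. by case/card_gt0P=> A; rewrite in_set => /andP[]; exists A. Qed.

Lemma linked_le1 u v : linked u v <= 1.
Proof.
apply/card_le1_eqP=> A B; rewrite in_set => /andP[bA lA].
rewrite in_set => /andP[bB lB].
exact: link_uniq bB bA lB lA.
Qed.

Lemma linkedxx u : linked u u = 0.
Proof.
apply/eqP; rewrite -leqn0 leqNgt; apply/negP=> /linked_gt0[A _].
by rewrite /link eqxx !andbF.
Qed.

(** If [u] were linked to both, it would lie in [A], so the block of the link [u x] would contain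
    [A] and, [A] being loose, equal it; but there [u x] is opposite to the apex. *)
Lemma linked_loose A x u : A \in loose_triangles -> x \in A :\ z A ->
  linked u (z A) + linked u x <= 1.
Proof.
move=> tA; rewrite !inE => /andP[xz xA].
have bA : A \in blocks by rewrite inE tA.
have cA : #|A| = 3 by move: tA; rewrite inE => /andP[/cliqueP[]].
have /andP[zA _] := z_apex tA.
have := linked_le1 u (z A); have := linked_le1 u x.
case: (posnP (linked u x)) => [->|/linked_gt0[B bB lB]]; first by lia.
case: (posnP (linked u (z A))) => [->|/linked_gt0[C bC lC]]; first by lia.
have ux := link_adj bB lB; have uz := link_adj bC lC.
have lA : link A x (z A) by rewrite /link xA zA xz eqxx !orbT.
have uA : u \in A by apply: link_closed bA lA ux uz.
have [t [tu tx EA]] := card3_split cA uA xA (adj_neq ux).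
have AB : A \subset B.
  apply: (link_sub bB bA lB) => //.
case/block_card: bB => [[tB cB]|[qB _]]; last first.
  by move: tA; rewrite inE => /andP[_ /forall_inP/(_ _ qB)]; rewrite AB.
have E : A = B by apply/eqP; rewrite eqEcard AB cA cB.
move: lB; rewrite -E => /and4P[_ _ _]; rewrite cA (negbTE xz) /= orbF.
by move/eqP => Eu; move: uz; rewrite -Eu eirr.
Qed.

(** A vertex of [K] is linked to at most the other three; one outside has at most one neighbour in
    [K]. *)
Lemma linked_clique4 K u : K \in cliques e 4 ->
  \sum_(a in K) linked u a <= 1 + 2 * (u \in K).
Proof.
move=> qK; have cK : #|K| = 4 by have [] := cliqueP qK.
case: (boolP (u \in K)) => uK.
  rewrite (bigD1 u) //= linkedxx add0n.
  apply: (@leq_trans (\sum_(a in K | a != u) 1)).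
    by apply: leq_sum => a _; apply: linked_le1.
  rewrite (eq_bigl (mem (K :\ u))) => [|a]; last by rewrite !inE andbC.
  by rewrite sum1_card; have := cardsD1 u K; rewrite uK cK; lia.
case: (boolP [exists a in K, 0 < linked u a]); last first.
  move=> H; rewrite big1 // => a aK; apply/eqP; rewrite -leqn0 leqNgt.
  by apply: contra H => H; apply/exists_inP; exists a.
case/exists_inP=> a aK ra; rewrite (bigD1 a) //= big1 ?addn0 ?linked_le1 //.
move=> b /andP[bK ba]; apply/eqP; rewrite -leqn0 leqNgt; apply/negP=> rb.
have [A bA lA] := linked_gt0 ra; have [B bB lB] := linked_gt0 rb.
have := clique4_outside qK bK aK ba uK.
by rewrite (link_adj bA lA) (link_adj bB lB).
Qed.

(** * Weighted degrees and double counting *)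

Definition deg (A : {set T}) (v : T) : nat := #|[set u | link A u v]|.
(** This is l(v): a loose triangle counts 2 at its apex and 1 at its other vertices. Next,
    [clique4_deg] is k(v). *)
Definition loose_deg (v : T) : nat := \sum_(A in loose_triangles) deg A v.
Definition clique4_deg (v : T) : nat := \sum_(K in cliques e 4) (v \in K).

Lemma deg_clique4 K v : K \in cliques e 4 -> deg K v = 3 * (v \in K).
Proof.
case/cliqueP=> cK _; rewrite /deg; case: (boolP (v \in K)) => vK; last first.
  by rewrite muln0; apply: eq_card0 => u; rewrite inE /link (negbTE vK) andbF.
have -> : [set u | link K u v] = K :\ v.
  by apply/setP=> u; rewrite !inE /link vK cK andbT /= andbC.
by have := cardsD1 v K; rewrite vK cK; lia.
Qed.

Lemma sum_linked v : \sum_u linked u v = loose_deg v + 3 * clique4_deg v.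
Proof.
have -> : \sum_u linked u v = \sum_(A in blocks) deg A v.
  under eq_bigr do rewrite /linked -sum1dep_card big_mkcondr.
  rewrite exchange_big /=; apply: eq_bigr => A _.
  by rewrite -big_mkcond /= sum1dep_card.
rewrite (eq_bigl [predU loose_triangles & cliques e 4]) => [|A]; last exact: in_setU.
rewrite bigU /=; last first.
  rewrite disjoint_subset; apply/subsetP=> A; rewrite inE => /andP[/cliqueP[cA _] _].
  by rewrite !inE cA.
congr (_ + _); rewrite big_distrr /=.
by apply: eq_bigr => K; apply: deg_clique4.
Qed.

(** Handshake over the two links of [A]: each contributes [f] at both its ends. *)
Lemma sum_deg_loose A (f : T -> nat) : A \in loose_triangles ->
  \sum_v deg A v * f v = \sum_(x in A :\ z A) (f (z A) + f x).
Proof.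
move=> tA; have cA : #|A| = 3 by move: tA; rewrite inE => /andP[/cliqueP[]].
have /andP[zA _] := z_apex tA.
have cAz : #|A :\ z A| = 2 by have := cardsD1 (z A) A; rewrite zA cA; lia.
rewrite (bigID (mem A)) /= addnC big1 => [|v vA]; last first.
  by rewrite /deg eq_card0 // => u; rewrite inE /link (negbTE vA) andbF.
rewrite add0n (bigD1 (z A)) //= big_split /= sum_nat_const cAz; congr (_ + _).
  congr (_ * _); rewrite -cAz; apply: eq_card => u.
  by rewrite !inE /link zA eqxx !orbT andbT /= andbC.
rewrite (eq_bigl (mem (A :\ z A))) => [|u]; last by rewrite !inE andbC.
apply: eq_bigr => x; rewrite !inE => /andP[xz xA].
rewrite -[RHS]mul1n; congr (_ * _); rewrite -(cards1 (z A)).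
apply: eq_card => u; rewrite !inE /link xA cA (negbTE xz) orbF /=.
by case: (eqVneq u (z A)) => [->|]; rewrite ?andbF // zA eq_sym xz.
Qed.

Lemma sum_loose_deg (f : T -> nat) :
  \sum_v loose_deg v * f v
    = \sum_(A in loose_triangles) \sum_(x in A :\ z A) (f (z A) + f x).
Proof.
under eq_bigr do rewrite big_distrl /=.
by rewrite exchange_big /=; apply: eq_bigr => A; apply: sum_deg_loose.
Qed.

Lemma sum_clique4_deg (f : T -> nat) :
  \sum_v clique4_deg v * f v = \sum_(K in cliques e 4) \sum_(a in K) f a.
Proof.
under eq_bigr do rewrite big_distrl /=.
rewrite exchange_big /=; apply: eq_bigr => K _; rewrite [RHS]big_mkcond /=.
by apply: eq_bigr => v _; case: (v \in K); rewrite ?mul1n.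
Qed.

Lemma sum_loose_const c :
  \sum_(A in loose_triangles) \sum_(x in A :\ z A) c = #|loose_triangles| * (2 * c).
Proof.
rewrite -sum_nat_const; apply: eq_bigr => A tA; rewrite sum_nat_const.
have /andP[zA _] := z_apex tA; move: tA; rewrite inE => /andP[/cliqueP[cA _] _].
by congr (_ * c); have := cardsD1 (z A) A; rewrite zA cA; lia.
Qed.

Lemma sum_linked_loose A x : A \in loose_triangles -> x \in A :\ z A ->
  \sum_u linked u (z A) + \sum_u linked u x <= #|T|.
Proof.
move=> tA xA; rewrite -big_split /= -sum1_card.
by apply: leq_sum => u _; apply: linked_loose.
Qed.

(** Each vertex contributes at most 1, and the four in [K] at most 2 more. *)
Lemma sum_linked_clique4 K : K \in cliques e 4 ->
  \sum_(a in K) \sum_u linked u a <= #|T| + 8.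
Proof.
move=> qK; have cK : #|K| = 4 by have [] := cliqueP qK.
rewrite exchange_big /=.
apply: (@leq_trans (\sum_u (1 + 2 * (u \in K)))).
  by apply: leq_sum => u _; apply: linked_clique4.
rewrite big_split /= sum1_card leq_add2l -big_distrr /= -big_mkcond /=.
by rewrite sum1_card cK.
Qed.

(** A triangle that is not loose lies in a K4, which has four triangles. *)
Lemma card_cliques3 : #|cliques e 3| <= #|loose_triangles| + 4 * #|cliques e 4|.
Proof.
pose P (K : {set T}) := [set A : {set T} | A \subset K & #|A| == 3].
have sub : cliques e 3 \subset loose_triangles :|: \bigcup_(K in cliques e 4) P K.
  apply/subsetP=> A tA; rewrite in_setU.
  case: (boolP (A \in loose_triangles)) => //=.
  rewrite inE tA => /forall_inPn[K qK]; rewrite negbK => AK.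
  apply/bigcupP; exists K => //; rewrite inE AK.
  by have [-> _] := cliqueP tA.
apply: leq_trans (subset_leq_card sub) _.
apply: leq_trans (leq_card_setU _ _) _; rewrite leq_add2l mulnC -sum_nat_const.
have H : #|\bigcup_(K in cliques e 4) P K| <= \sum_(K in cliques e 4) #|P K|.
  elim/big_rec2: _ => [|K s B _ IH]; first by rewrite cards0.
  by apply: leq_trans (leq_card_setU _ _) _; rewrite leq_add2l.
apply: leq_trans H _; apply: leq_sum => K /cliqueP[cK _].
by rewrite cards_draws cK.
Qed.

Lemma sum_sqr_deg : 16 <= #|T| ->
  \sum_v (loose_deg v + 4 * clique4_deg v) ^ 2
    <= 2 * #|T| * (#|loose_triangles| + 4 * #|cliques e 4|).
Proof.
move=> n16; set n := #|T| in n16 *.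
(* Here [D] is l alone, not the weight l + 4k. *)
set D := fun v => loose_deg v; set k := fun v => clique4_deg v.
pose d v := \sum_u linked u v.
have dE v : d v = D v + 3 * k v by apply: sum_linked.
have H1 : \sum_v D v * d v <= #|loose_triangles| * (2 * n).
  rewrite sum_loose_deg -sum_loose_const.
  by apply: leq_sum => A tA; apply: leq_sum => x xA; apply: sum_linked_loose.
have H2 : \sum_v k v * (16 * d v) <= #|cliques e 4| * (16 * (n + 8)).
  rewrite sum_clique4_deg -sum_nat_const; apply: leq_sum => K qK.
  by rewrite -big_distrr leq_mul2l sum_linked_clique4 // orbT.
(* With d = D + 3k, the right side exceeds the left by D k at each vertex. *)
have H3 : 3 * \sum_v (D v + 4 * k v) ^ 2
    <= 3 * \sum_v D v * d v + \sum_v k v * (16 * d v).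
  rewrite !big_distrr -big_split /=; apply: leq_sum => v _; rewrite dE.
  by nia.
(* 16 (n + 8) <= 24 n amounts to n >= 16. *)
have H4 : #|cliques e 4| * (16 * (n + 8)) <= #|cliques e 4| * (24 * n).
  by rewrite leq_mul2l; apply/orP; right; lia.
by rewrite -(leq_pmul2l (isT : 0 < 3)); apply: leq_trans H3 _; lia.
Qed.

Lemma card_cliques3_leq : 16 <= #|T| -> 8 * #|cliques e 3| <= #|T| ^ 2.
Proof.
(* This [t] also includes the K4s, four for each; the weights sum to 4t, so Cauchy-Schwarz gives 16
   t^2 <= 2 n^2 t. *)
move=> n16; set t := #|loose_triangles| + 4 * #|cliques e 4|.
apply: (@leq_trans (8 * t)); first by rewrite leq_mul2l card_cliques3.
have := sum_sqr_leq (fun v => loose_deg v + 4 * clique4_deg v).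
have -> : \sum_v (loose_deg v + 4 * clique4_deg v) = 4 * t.
  rewrite big_split -big_distrr /=.
  have -> : \sum_v loose_deg v = #|loose_triangles| * (2 * 2).
    rewrite -sum_loose_const -(sum_loose_deg (fun=> 1)).
    by apply: eq_bigr => v _; rewrite muln1.
  have -> : \sum_v clique4_deg v = #|cliques e 4| * 4.
    transitivity (\sum_v clique4_deg v * 1); first by apply: eq_bigr => v _; rewrite muln1.
    rewrite sum_clique4_deg -sum_nat_const; apply: eq_bigr => K /cliqueP[cK _].
    by rewrite sum1_card.
  by rewrite /t; lia.
have := sum_sqr_deg n16; rewrite -/t => H1 H2.
case: (posnP t) => [->|t0]; first by lia.
have H : 16 * t ^ 2 <= 2 * #|T| ^ 2 * t.
  have := leq_mul (leqnn #|T|) H1; nia.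
have : (8 * t) * (2 * t) <= #|T| ^ 2 * (2 * t) by nia.
by rewrite leq_pmul2r // muln_gt0.
Qed.

End TriangleBound.

Lemma fan_free_triangles (T : finType) (e : rel T) :
    symmetric e -> irreflexive e ->
    fan_free e ->
  16 <= #|T| -> 8 * #|cliques e 3| <= #|T| ^ 2.
Proof.
move=> esym eirr efan n16.
(* Default value of the apex function on sets that are not loose triangles. *)
have /card_gt0P[x0 _] : 0 < #|T| by lia.
have /fin_all_exists[z zP] A :
    exists z, A \in loose_triangles e -> apex e A z.
  case: (boolP (A \in loose_triangles e)) => [|_]; last by exists x0.
  by case/(loose_apex esym efan) => z zP; exists z.
exact: (card_cliques3_leq esym eirr efan zP).
Qed.

(** * From [sgraph] and copies to adjacency relations and cliques *)

Lemma imset_pair (S T : finType) (f : S -> T) x y :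
  f @: [set x; y] = [set f x; f y].
Proof. by rewrite imsetU !imset_set1. Qed.

Section Graphs.

Variable T : finType.
Implicit Types (G : sgraph T) (e : rel T).

Definition adj G : rel T := fun x y => [set x; y] \in edges G.

Lemma adj_sym G : symmetric (adj G).
Proof. by move=> x y; rewrite /adj setUC. Qed.

Lemma adj_irr G : irreflexive (adj G).
Proof.
move=> x; apply/negP=> /(forall_inP (edges_card2 G)).
by rewrite setUid cards1.
Qed.

Lemma adj_surj e : symmetric e -> irreflexive e -> exists G, adj G =2 e.
Proof.
move=> esym eirr.
have H : [forall d in [set [set p.1; p.2] | p : T * T & e p.1 p.2], #|d| == 2].
  apply/forall_inP=> d /imsetP[[x y] /=]; rewrite inE /= => exy ->.
  by rewrite cards2; case: (eqVneq x y) exy => // ->; rewrite eirr.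
exists (SGraph H) => x y; apply/imsetP/idP => [[[u v]]|exy]; last first.
  by exists (x, y); rewrite ?inE.
rewrite inE /= => euv E.
have nxy : x != y.
  have : #|[set x; y]| = 2 by rewrite E cards2; case: (eqVneq u v) euv => // ->; rewrite eirr.
  by rewrite cards2; case: (eqVneq x y).
have : x \in [set u; v] by rewrite -E set21.
have : y \in [set u; v] by rewrite -E set22.
rewrite !inE => /orP[]/eqP Ey /orP[]/eqP Ex; move: nxy; rewrite Ex Ey ?eqxx //.
by rewrite esym.
Qed.

(** The image of an embedding is a copy, and an isomorphism onto a copy is an embedding. *)
Lemma freeP (U : finType) (F : sgraph U) G :
  reflect (forall f : U -> T, injective f ->
             ~ (forall d : {set U}, d \in edges F -> f @: d \in edges G))
    (free F G).
Proof.
apply: (iffP eqP) => [E0 f inj_f fG|H]; last first.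
  apply/setP=> S; rewrite in_set0; apply/negP.
  rewrite inE => /andP[/andP[/subsetP sub _] /existsP[f /and3P[/injectiveP inj_f _ /eqP E]]].
  by apply: (H f inj_f) => d dF; apply: sub; rewrite -E; apply/imset_f.
have : (f @: [set: U], [set f @: (d : {set U}) | d in edges F]) \in copies F G.
  rewrite inE; apply/andP; split.
    apply/andP; split=> /=; first by apply/subsetP=> ? /imsetP[d dF ->]; apply: fG.
    by apply/forall_inP=> ? /imsetP[d dF ->]; apply: imsetS; apply: subsetT.
  apply/existsP; exists [ffun x => f x]; apply/and3P; split=> /=.
  - by apply/injectiveP=> x y; rewrite !ffunE; apply: inj_f.
  - by apply/eqP/eq_imset => x; rewrite ffunE.
  - by apply/eqP/eq_imset => d; apply/eq_imset => x; rewrite ffunE.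
by rewrite E0 in_set0.
Qed.

Lemma imset_complete_edges (U : finType) (f : U -> T) : injective f ->
  [set f @: (d : {set U}) | d in edges (complete_graph U)]
    = [set d : {set T} | (d \subset f @: [set: U]) && (#|d| == 2)].
Proof.
move=> inj_f; apply/setP=> d; apply/imsetP/idP => [[c /=]|].
  by rewrite in_set => cc ->; rewrite inE card_imset // cc imsetS ?subsetT.
rewrite inE => /andP[sub cd]; have E : d = f @: (f @^-1: d).
  apply/setP=> x; apply/idP/imsetP => [xd|[u]]; last by rewrite inE => ? ->.
  by have /imsetP[u _ xE] := subsetP sub x xd; exists u; rewrite // inE -xE.
by exists (f @^-1: d); rewrite //= inE -(card_imset _ inj_f) -E.
Qed.

(** A copy of a complete graph is determined by its vertex set, a clique; its edges are all pairs
    inside. *)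
Lemma card_copies_complete (U : finType) G :
  #|copies (complete_graph U) G| = #|cliques (adj G) #|U| |.
Proof.
pose F (A : {set T}) := (A, [set d : {set T} | (d \subset A) && (#|d| == 2)]).
have inj_F : injective F by move=> A B [].
rewrite -(card_imset _ inj_F); apply: eq_card => S.
apply/idP/imsetP => [|[A /cliqueP[cA eA] ->]].
  rewrite inE => /andP[/andP[/subsetP sub _] /existsP[f]].
  case/and3P=> /injectiveP inj_f /eqP E1; rewrite imset_complete_edges // E1 => /eqP E2.
  exists S.1; last by case: S {sub E1} E2 => ? ? /= <-.
  apply/cliqueP; split=> [|x y xS yS xy]; first by rewrite -E1 card_imset // cardsT.
  by apply: sub; rewrite -E2 inE cards2 xy subUset !sub1set xS yS.
rewrite inE; apply/andP; split.
  apply/andP; split=> /=; last by apply/forall_inP=> d; rewrite inE => /andP[].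
  apply/subsetP=> d; rewrite inE => /andP[/subsetP dA /cards2P[x [y [xy Ed]]]].
  rewrite Ed -/(adj G x y) eA //; apply: dA; first by rewrite Ed set21.
  by rewrite Ed set22.
pose f u := enum_val (cast_ord (esym cA) (enum_rank u)).
have inj_f : injective f.
  by move=> u v /enum_val_inj/cast_ord_inj/enum_rank_inj.
have fA : f @: [set: U] = A.
  apply/eqP; rewrite eqEcard card_imset // cardsT cA leqnn andbT.
  by apply/subsetP=> ? /imsetP[u _ ->]; apply: enum_valP.
apply/existsP; exists [ffun u => f u].
have Ef : [ffun u => f u] =1 f by move=> u; rewrite ffunE.
have inj_f' : injective [ffun u => f u] by apply: eq_inj inj_f _ => u; rewrite Ef.
by rewrite imset_complete_edges // (eq_imset _ Ef) fA !eqxx; apply/and3P; split=> //; apply/injectiveP.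
Qed.

Lemma free_fan G : free (suspension P4) G <-> fan_free (adj G).
Proof.
split=> [/freeP H v a b c d|H].
  case/and3P=> ac ad bd /and4P[va vb vc vd]; apply/negP=> /and3P[ab bc cd].
  pose s := [:: a; b; c; d].
  (* The default [v] of [nth] is never reached, since indices are below 4. *)
  pose f (o : option 'I_4) := if o is Some i then nth v s i else v.
  have neq := adj_neq (@adj_irr G).
  have us : uniq s by rewrite /= !inE !negb_or (neq _ _ ab) (neq _ _ bc) (neq _ _ cd) ac ad bd.
  have vs : v \notin s by rewrite !inE !negb_or !neq.
  have vi (i : 'I_4) : v <> nth v s i.
    by move=> E; case/negP: vs; rewrite {1}E mem_nth //; apply: (ltn_ord i).
  apply: (H f) => [[i|] [j|]|e] /=; rewrite ?inE.
  - by move/eqP; rewrite nth_uniq ?ltn_ord // => /eqP/val_inj ->.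
  - by move=> E; case: (vi i).
  - by move=> E; case: (vi j).
  - by [].
  case/orP=> /imsetP[].
    move=> d0; rewrite inE => /existsP[i /existsP[j /andP[/eqP ij /eqP ->]]] ->.
    rewrite !imset_pair /f -/(adj G _ _) ij.
    by case: i ij => [[|[|[|[|?]]]] ?] //= ij; have := ltn_ord j; rewrite ij.
  move=> i _ ->; rewrite imset_pair /f -/(adj G _ _).
  by case: i => [[|[|[|[|?]]]] ?].
apply/freeP=> f inj_f fG.
pose o k (k4 : k < 4) := f (Some (Ordinal k4)).
have fe (i j : 'I_4) : j = i.+1 :> nat -> adj G (f (Some i)) (f (Some j)).
  move=> ij; rewrite /adj -imset_pair; apply: fG.
  rewrite inE -imset_pair; apply/orP; left; apply/imsetP.
  exists [set i; j] => //; rewrite inE.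
  by apply/existsP; exists i; apply/existsP; exists j; rewrite ij !eqxx.
have fn (i : 'I_4) : adj G (f None) (f (Some i)).
  rewrite /adj -imset_pair; apply: fG.
  by rewrite inE; apply/orP; right; apply/imsetP; exists i.
have := H (f None) (o 0 isT) (o 1 isT) (o 2 isT) (o 3 isT).
by rewrite /o !fn !fe // !(inj_eq inj_f) => /(_ isT isT).
Qed.

End Graphs.

(** * The extremal construction *)

Section MatchingJoin.

Variables (n k : nat).

(* The matching pairs [2i] with [2i + 1], for [i < k]. *)
Definition matching_join : rel 'I_n := fun i j =>
  if (i < 2 * k) && (j < 2 * k) then (i != j) && (i./2 == j./2)
  else (i < 2 * k) (+) (j < 2 * k).

Lemma matching_join_sym : symmetric matching_join.
Proof.
move=> i j; rewrite /matching_join andbC eq_sym [_./2 == _]eq_sym addbC.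
by [].
Qed.

Lemma matching_join_irr : irreflexive matching_join.
Proof. by move=> i; rewrite /matching_join andbb eqxx addbb; case: ifP. Qed.

(** The neighbourhood of a matched vertex is a star around its partner, that of an independent
    vertex a matching; neither contains a P4. The case split is over the sides of the five
    vertices. *)
Lemma matching_join_fan_free : fan_free matching_join.
Proof.
move=> v a b c d; rewrite /matching_join -!val_eqE /=.
move=> H1 H2; apply/negP => H3; move: H1 H2 H3.
case: (ltnP v (2 * k)) => _; case: (ltnP a (2 * k)) => _; case: (ltnP b (2 * k)) => _;
  case: (ltnP c (2 * k)) => _; case: (ltnP d (2 * k)) => _ //=; rewrite ?andbF //; lia.
Qed.

End MatchingJoin.

(** Each matching edge forms a triangle with each independent vertex. *)
Lemma card_matching_join_triangles n k : 2 * k <= n ->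
  k * (n - 2 * k) <= #|cliques (@matching_join n k) 3|.
Proof.
case: n => [|n] kn; first by rewrite muln0.
pose F (p : 'I_k * 'I_(n.+1 - 2 * k)) : {set 'I_n.+1} :=
  [set inord (2 * p.1); inord (2 * p.1).+1; inord (2 * k + p.2)].
have vals (p : 'I_k * 'I_(n.+1 - 2 * k)) :
  [/\ (inord (2 * p.1) : 'I_n.+1) = 2 * p.1 :> nat,
      (inord (2 * p.1).+1 : 'I_n.+1) = (2 * p.1).+1 :> nat
    & (inord (2 * k + p.2) : 'I_n.+1) = 2 * k + p.2 :> nat].
  have := ltn_ord p.1; have := ltn_ord p.2.
  by split; apply: inordK; lia.
have inj_F : injective F.
  move=> p q E; have [v1 v2 v3] := vals p; have [w1 w2 w3] := vals q.
  have lp := ltn_ord p.1; have lq := ltn_ord q.1.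
  (* An even element of [F q] below 2k is [2 * q.1], and an element from 2k on is [2 * k + q.2]. *)
  have : inord (2 * p.1) \in F q by rewrite -E !inE eqxx.
  have : inord (2 * k + p.2) \in F q by rewrite -E !inE eqxx !orbT.
  rewrite !inE -!val_eqE /= v1 v3 w1 w2 w3 => H3 H1.
  have E1 : p.1 = q.1 by apply: val_inj => /=; lia.
  have E2 : p.2 = q.2 by apply: val_inj => /=; lia.
  by case: p q E1 E2 {E v1 v2 v3 w1 w2 w3 lp lq H1 H3} => [? ?] [? ?] /= -> ->.
have -> : k * (n.+1 - 2 * k) = #|F @: [set: 'I_k * 'I_(n.+1 - 2 * k)]|.
  by rewrite card_imset // cardsT card_prod !card_ord.
apply/subset_leq_card/subsetP=> ? /imsetP[p _ ->].
have [v1 v2 v3] := vals p; have lp := ltn_ord p.1.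
apply/cliqueP; split=> [|x y].
  rewrite /F setUC cardsU1 cards2 !inE -!val_eqE /= v1 v2 v3.
  have -> : (2 * k + p.2 == 2 * p.1) = false by lia.
  have -> : (2 * k + p.2 == (2 * p.1).+1) = false by lia.
  by rewrite ltn_eqF.
have l1 : 2 * p.1 < 2 * k by lia.
have l2 : (2 * p.1).+1 < 2 * k by lia.
have l3 : (2 * k + p.2 < 2 * k) = false by lia.
have half : (2 * p.1)./2 = (2 * p.1).+1./2 by lia.
rewrite /F !inE -!orbA /matching_join -!val_eqE /=.
by move=> /or3P[]/eqP-> /or3P[]/eqP->; 
  rewrite ?v1 ?v2 ?v3 ?l1 ?l2 ?l3 //=; lia.
Qed.

Theorem theorem1p2 :
  exists n0 : nat, forall n : nat, n0 <= n ->
    turan_ex n K3 (suspension P4) = (n ^ 2) %/ 8.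
Proof.
exists 16 => n n16; apply/eqP; rewrite eqn_leq; apply/andP; split.
  apply/bigmax_leqP=> G /free_fan efan.
  rewrite card_copies_complete card_ord leq_divRL // mulnC.
  have := fan_free_triangles (@adj_sym _ G) (@adj_irr _ G) efan.
  by rewrite card_ord; apply.
(* Over the reals n/4 maximizes k (n - 2k); this rounds it to the nearest integer, down at a tie. *)
pose k := n.+1 %/ 4.
have [G GE] := adj_surj (@matching_join_sym n k) (@matching_join_irr n k).
have efree : free (suspension P4) G.
  apply/free_fan => v a b c d; rewrite !GE; exact: matching_join_fan_free.
apply: leq_trans (leq_bigmax_cond _ efree).
rewrite card_copies_complete card_ord.
have -> : cliques (adj G) 3 = cliques (@matching_join n k) 3.
  apply/setP=> A; apply/cliqueP/cliqueP => -[cA eA]; split=> // x y xA yA xy.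
    by rewrite -GE; apply: eA.
  by rewrite GE; apply: eA.
apply: leq_trans (card_matching_join_triangles _); last by rewrite /k; lia.
rewrite /k; have := divn_eq n.+1 4; have := ltn_pmod n.+1 (isT : 0 < 4).
set q := _ %/ 4; set r := _ %% 4 => r4 E.
have -> : n ^ 2 = n * n by rewrite mulnn.
(* With k = [q] and n = 4q + r - 1, n^2 - 8 k (n - 2k) = (n - 4k)^2 = (r - 1)^2 <= 4 < 8, so the
   floor absorbs the difference. *)
rewrite -ltnS ltn_divLR //.
have : r = 0 \/ r = 1 \/ r = 2 \/ r = 3 by lia.
have -> : n = q * 4 + r - 1 by lia.
nia.
Qed.
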